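(* Let $q$ be such that $\pm q$ is a PV number (i.e. $q$ or $-q$ is a PV number). Suppose that $\alpha \in \mathcal{O}_q$ satisfies $$0 < \min\{1, |\alpha|\} \, H_q(\alpha) < |q|.$$ Then, for every integer $m \geq 0$, the numbers $$1, \ T_q(\alpha), \ T_q^{(1)}(\alpha), \ \ldots, \ T_q^{(m)}(\alpha)$$ are linearly independent over $\mathbb{Q}(q)$.
   Context: A real algebraic integer $\omega$ is called a Pisot–Vijayraghavan number (PV number) if $\omega > 1$ and all other Galois conjugates $\omega^{(j)}$ of $\omega$ satisfy $|\omega^{(j)}| < 1$ (in particular, integers greater than $1$ are PV numbers). For an algebraic integer $q \neq 0$, $n_q = [\mathbb{Q}(q):\mathbb{Q}]$; $\sigma_1, \ldots, \sigma_{n_q}$ denote the embeddings of $\mathbb{Q}(q)$ into $\mathbb{C}$, with $\sigma_1$ the identity; $\mathcal{O}_q$ is the ring of integers of $\mathbb{Q}(q)$. For $\alpha \in \mathbb{Q}(q)$, the $q$-relative height is $$H_q(\alpha) = \prod_{l=1}^{n_q} \max\{1, |\sigma_l(\alpha)|\}.$$ For $q$ with $|q|>1$, the Tschakaloff function is $$T_q(x) = 1 + \sum_{n=1}^{\infty} \frac{x^n}{q^{n(n+1)/2}},$$ and $T_q^{(j)}$ denotes its $j$-th derivative with respect to $x$. *)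

(* Defs.v *)
From HB Require Import structures.
From mathcomp Require Import all_boot all_order all_algebra.
From mathcomp Require Import complex.
From mathcomp Require Import all_classical all_reals all_analysis.

Set Implicit Arguments.
Unset Strict Implicit.
Unset Printing Implicit Defensive.

Import Order.TTheory GRing.Theory Num.Theory.
Import numFieldNormedType.Exports.

Local Open Scope classical_set_scope.
Local Open Scope ring_scope.

(* Q(q) is the smallest subfield of R containing q. *)
Definition in_Qadj (R : realType) (q : R) : {pred R} :=
  fun x => `[< forall K : {pred R}, divring_closed K -> q \in K -> x \in K >].

Lemma in_Qadj_divring_closed (R : realType) (q : R) :
  divring_closed (in_Qadj q).
Proof.
split.
- by apply/asboolP => K [].
- move=> x y /asboolP hx /asboolP hy; apply/asboolP => K hK hq.
  by case: (hK) => _ hB _; apply: hB; [apply: hx | apply: hy].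
- move=> x y /asboolP hx /asboolP hy; apply/asboolP => K hK hq.
  by case: (hK) => _ _ hD; apply: hD; [apply: hx | apply: hy].
Qed.

HB.instance Definition _ (R : realType) (q : R) :=
  GRing.isDivringClosed.Build R (in_Qadj q) (in_Qadj_divring_closed q).

Record Qadj (R : realType) (q : R) := MkQadj {
  Qadj_val : R;
  Qadj_valP : Qadj_val \in in_Qadj q }.

HB.instance Definition _ (R : realType) (q : R) :=
  [isSub for @Qadj_val R q].
HB.instance Definition _ (R : realType) (q : R) :=
  [Choice of Qadj q by <:].
HB.instance Definition _ (R : realType) (q : R) :=
  [SubChoice_isSubIntegralDomain of Qadj q by <:].
HB.instance Definition _ (R : realType) (q : R) :=
  [SubIntegralDomain_isSubField of Qadj q by <:].

Definition embeddings (R : realType) (q : R) : set (Qadj q -> R[i]) :=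
  [set s | exists f : {rmorphism Qadj q -> R[i]},
     s = f :> (Qadj q -> R[i])].
Arguments embeddings {R} q _.

(* The product is over a finite set when q is algebraic.  The norm of R[i] is
   R[i]-valued, whereas Normc.normc is the modulus as an element of R. *)
Definition height (R : realType) (q : R) (a : Qadj q) : R :=
  \big[*%R/1]_(s \in embeddings q) Num.max 1 (Normc.normc (s a)).

Definition conjugates (R : realType) (x : R) : set R[i] :=
  [set z | exists p : {poly rat}, [/\ irreducible_poly p,
     root (map_poly ratr p) x & root (map_poly ratr p) z]].

Definition PV_number (R : realType) (w : R) : Prop :=
  [/\ integralOver (intr : int -> R) w, 1 < w &
      forall z : R[i], conjugates w z -> z <> (w%:C)%C -> Normc.normc z < 1].

Definition Tschakaloff (R : realType) (q x : R) : R :=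
  1 + \big[+%R/0]_(1 <= n <oo) (x ^+ n / q ^+ (n * n.+1)./2).

(* L is regarded as a K-vector space via iota. *)
Definition lin_indep (K L : fieldType) (iota : {rmorphism K -> L})
    (s : seq L) : Prop :=
  forall c : 'I_(size s) -> K,
    \sum_(i < size s) iota (c i) * s`_i = 0 -> forall i, c i = 0.

(* Main.v *)
Require Import Defs.
From HB Require Import structures.
From mathcomp Require Import all_boot all_order all_algebra all_field.
From mathcomp Require Import complex.
From mathcomp Require Import all_classical all_reals all_analysis.
From mathcomp Require Import ring.

Set Implicit Arguments.
Unset Strict Implicit.
Unset Printing Implicit Defensive.

Import Order.TTheory GRing.Theory Num.Theory.
Import numFieldNormedType.Exports.

Local Open Scope classical_set_scope.
Local Open Scope ring_scope.

(** Write T for the Tschakaloff function and K for Q(q).  Since T is entire,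
    a K-linear relation between 1 and the values T^(j)(alpha), j <= m, reads
    A + sum_k b_k / q^(k(k+1)/2) = 0, where
    b_k = sum_j A_j k(k-1)...(k-j+1) alpha^(k-j).  After multiplication by a
    common denominator, A and all the A_j are algebraic integers.

    Multiplying the n-th tail of this series by q^(n(n-1)/2) gives the sequence
    u_0 = - A, u_(n+1) = q^n u_n - b_n, which consists of algebraic integers
    of K.  Fix rho > 1.  The factors k(k-1)...(k-j+1) are O(rho^k), so two
    bounds hold.
    - As the scaled tail of a very rapidly convergent series, u_n is
      O((rho |alpha| / |q|)^n) (val_remainder_bound).
    - For every embedding s of K other than the identity, |s q| < 1 because q
      or - q is a PV number, and the recurrence shows that s u_n is
      O((rho max(1, |s alpha|))^n) (remainder_bound).
    The product over all embeddings, which is the absolute value of the norm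
    of u_n, is therefore O((rho^N theta)^n) with N = [K : Q] and
    theta = |alpha| prod_(s <> id) max(1, |s alpha|) / |q|.  Because
    |alpha| = min(1, |alpha|) max(1, |alpha|), this theta is
    min(1, |alpha|) H_q(alpha) / |q|, which is less than 1 by hypothesis; so
    rho can be chosen with rho^N theta < 1, and the norm of u_n tends to 0.
    But the norm of a nonzero algebraic integer is a nonzero integer
    (prod_roots_ge1, embeddings_enum).  Hence u_n = 0 for all large n, so
    b_n = q^n u_n - u_(n+1) = 0 for all large n.  As alpha <> 0, a combination
    of falling factorials of n vanishes for all large n, and its coefficients
    must be zero (ffact_free).  Then all the A_j vanish, and so does A. *)

(** * Norms of algebraic integers *)

(** Factor g = c * prod_j ('X - w_j): then g(A) is a product of matrices
    A - w_j, and the determinant of A - w_j is, up to sign, the characteristic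
    polynomial of A at w_j.  Exchanging the two products gives the right-hand
    side, so A need not be diagonalized. *)
Lemma det_horner_mx (F : closedFieldType) (n : nat) (A : 'M[F]_n.+1)
    (zs : seq F) (g : {poly F}) :
  char_poly A = \prod_(z <- zs) ('X - z%:P) ->
  \det (horner_mx A g) = \prod_(z <- zs) g.[z].
Proof.
move=> Azs.
have szs : size zs = n.+1.
  by apply: succn_inj; rewrite -(size_char_poly A) Azs size_prod_XsubC.
have constE (c : F) : \prod_(z <- zs) c = c ^+ n.+1.
  by rewrite big_const_seq count_predT iter_mulr_1 szs.
have det_lin (w : F) : \det (A - w%:M) = \prod_(z <- zs) (z - w).
  have -> : A - w%:M = -1 *: (w%:M - A) by rewrite scaleN1r opprB.
  rewrite detZ; have <- : (char_poly A).[w] = \det (w%:M - A).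
    rewrite -horner_evalE -det_map_mx; congr (\det _).
    apply/matrixP => i j; rewrite !mxE -[LHS]/(_.[w]).
    by rewrite hornerD hornerN hornerMn hornerX hornerC.
  rewrite Azs horner_prod -constE -big_split /=.
  by apply: eq_bigr => z _; rewrite hornerXsubC mulN1r opprB.
have [ws ->] := closed_field_poly_normal g; set c := lead_coef g.
rewrite linearZ /= detZ rmorph_prod /=.
rewrite (big_morph (determinant (n := n.+1)) (@detM _ _) (det1 _ _)).
rewrite -constE.
under [in RHS]eq_bigr do rewrite hornerZ horner_prod.
rewrite [RHS]big_split /= exchange_big /=; congr (_ * _).
apply: eq_bigr => w _; rewrite rmorphB /= horner_mx_X horner_mx_C det_lin.
by apply: eq_bigr => z _; rewrite hornerXsubC.
Qed.

Lemma exists_companion (F : fieldType) (n : nat) (p : {poly F}) :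
  p \is monic -> size p = n.+2 -> exists A : 'M[F]_n.+1, char_poly A = p.
Proof.
move=> mp sp; have sz : n.+1 = (size p).-1 by rewrite sp.
move: (n.+1) sz => m ->; exists (companionmx p); exact: companionmxK.
Qed.

(** The product is the determinant of g evaluated at the companion matrix of
    p, a matrix with rational entries. *)
Lemma prod_roots_rational (C : numClosedFieldType) (p g : {poly rat})
    (zs : seq C) :
  (1 < size p)%N -> p \is monic ->
  map_poly ratr p = \prod_(z <- zs) ('X - z%:P) ->
  exists r : rat, \prod_(z <- zs) (map_poly ratr g).[z] = ratr r.
Proof.
case sp: (size p) => [|[|n]] // _ mp pzs.
have [A Ap] := exists_companion mp sp.
exists (\det (horner_mx A g)).
rewrite -det_map_mx map_horner_mx; apply/esym/det_horner_mx.
by rewrite -pzs -Ap map_char_poly.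
Qed.

(** A monic integer polynomial that vanishes at r in F also vanishes at r in
    the algebraic numbers, whose rational integral elements are integers. *)
Lemma rat_integral_int (F : numFieldType) (r : rat) :
  integralOver (intr : int -> F) (ratr r) -> r \is a Num.int.
Proof.
have intrE (E : numFieldType) (p : {poly int}) :
    map_poly (intr : int -> E) p =
    map_poly ratr (map_poly (intr : int -> rat) p).
  by rewrite -map_poly_comp; apply: eq_map_poly => b; rewrite /= ratr_int.
case=> p mp; rewrite intrE fmorph_root => rp.
have Ar : (ratr r : algC) \in Aint.
  apply: (@root_monic_Aint (map_poly intr p)).
  - by rewrite intrE fmorph_root.
  - by rewrite monic_map.
  - by apply/polyOverP => i; rewrite coef_map; apply: rpred_int.
have : (ratr r : algC) \in Num.int.
  apply: Cint_rat_Aint => //; exact: Crat_rat.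
by case/intrP => z; rewrite -(ratr_int _ z) => /fmorph_inj ->; exact: rpred_int.
Qed.

(** This is the norm of the algebraic integer g(z): it is rational by
    [prod_roots_rational] and integral as a product of integral elements, so
    it is an integer, and it is not zero. *)
Lemma prod_roots_ge1 (C : numClosedFieldType) (p g : {poly rat}) (zs : seq C) :
  (1 < size p)%N -> p \is monic ->
  map_poly ratr p = \prod_(z <- zs) ('X - z%:P) ->
  {in zs, forall z, integralOver (intr : int -> C) (map_poly ratr g).[z]} ->
  {in zs, forall z, (map_poly ratr g).[z] != 0} ->
  1 <= \prod_(z <- zs) `|(map_poly ratr g).[z]|.
Proof.
move=> sp mp pzs gint gn0; have [r rE] := prod_roots_rational g sp mp pzs.
rewrite -normr_prod rE.
have /intrP[z zE] : r \is a Num.int.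
  apply: (@rat_integral_int C); rewrite -rE big_seq.
  apply: (big_ind (integralOver (intr : int -> C))) => //.
  - exact: integral1.
  - by move=> x y; apply: integral_mul.
have : ratr r != 0 :> C.
  by rewrite -rE prodf_seq_neq0; apply/allP => w wz /=; exact: gn0.
rewrite zE ratr_int intr_eq0 -intr_norm ler1z => z0.
exact: norm_intr_ge1.
Qed.

(** In characteristic 0 the derivative of p is nonzero of smaller degree, so
    an irreducible p cannot divide it. *)
Lemma irreducible_separable (F : numFieldType) (p : {poly F}) :
  irreducible_poly p -> separable_poly p.
Proof.
move=> [sp pirr]; rewrite unlock; apply/coprimepP => d dp dp'.
case: (altP (size d =P 1%N)) => [|sd]; first by rewrite -size_poly_eq1 => ->.
have p0 : p != 0 by rewrite -size_poly_gt0 ltnW.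
have p'0 : p^`() != 0.
  apply/eqP => /polyP/(_ (size p).-2)/eqP; rewrite coef_deriv coef0.
  have sE : ((size p).-2.+1 = (size p).-1)%N by case: (size p) sp => [|[]].
  by rewrite mulrn_eq0 /= sE -lead_coefE lead_coef_eq0 (negPf p0).
have := dvdp_leq p'0 dp'; rewrite (eqp_size (pirr d sd dp)) leqNgt.
by rewrite lt_size_deriv.
Qed.

(** * The field Q(q) and its embeddings *)

Lemma irreducible_dvdp_root (F : fieldType) (L : fieldType)
    (i : {rmorphism F -> L}) (p g : {poly F}) (x : L) :
  irreducible_poly p -> root (map_poly i p) x -> root (map_poly i g) x ->
  p %| g.
Proof.
move=> pirr px gx; have [cpg|] := boolP (coprimep p g).
  have := coprimep_root (q := map_poly i g) _ px.
  by rewrite coprimep_map => /(_ cpg); rewrite (rootP gx) eqxx.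
have [_ /(_ (gcdp p g)) h] := pirr; rewrite /coprimep => /h.
by move=> /(_ (dvdp_gcdl _ _))/andP[_ /dvdp_trans]; apply; exact: dvdp_gcdr.
Qed.

(** A polynomial of least degree vanishing at x is irreducible: a proper
    factorization would give a smaller one. *)
Lemma exists_minpoly (F L : fieldType) (i : {rmorphism F -> L}) (x : L) :
  integralOver i x ->
  exists p : {poly F},
    [/\ irreducible_poly p, p \is monic & root (map_poly i p) x].
Proof.
move=> [p0 mp0 p0x].
pose P n := `[< exists p : {poly F}, [/\ p \is monic, root (map_poly i p) x &
  size p = n] >].
have exP : exists n, P n by exists (size p0); apply/asboolP; exists p0.
have [n /asboolP[p [mp px sp]] nmin] := ex_minnP exP; exists p; split=> //.
have min d : d != 0 -> root (map_poly i d) x -> (size p <= size d)%N.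
  move=> d0 dx; rewrite sp; apply: nmin; apply/asboolP.
  have l0 : lead_coef d != 0 by rewrite lead_coef_eq0.
  exists ((lead_coef d)^-1 *: d); split.
  - by rewrite monicE lead_coefZ mulVf.
  - by rewrite map_polyZ rootE hornerZ (rootP dx) mulr0.
  - by rewrite size_scale // invr_eq0.
have p0' := monic_neq0 mp.
split.
  rewrite ltnNge; apply/negP => /size1_polyC pE; move: px.
  by rewrite pE map_polyC rootC fmorph_eq0 -polyC_eq0 -pE (negPf p0').
move=> d sd dp; rewrite -dvdp_size_eqp //.
have d0 : d != 0 by apply: contraNneq p0' => d0; rewrite -dvd0p -d0.
have e0 : p %/ d != 0 by rewrite dvdp_div_eq0.
move: px; rewrite -(divpK dp) rmorphM rootM => /orP[ex|dx].
- have := min _ e0 ex; rewrite -{1}(divpK dp) size_mul //.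
  move: sd; rewrite -size_poly_gt0 in d0; case: (size d) d0 => [|[|m]] //= _ _.
  by rewrite !addnS /= -addSn leqNgt ltnS leq_addr.
- by rewrite divpK // eqn_leq min // dvdp_leq.
Qed.

Section Adjunction.
Variables (R : realType) (q : R).

Lemma in_Qadj_gen : q \in in_Qadj q.
Proof. by apply/asboolP. Qed.

Definition Qgen : Qadj q := MkQadj in_Qadj_gen.

(** The elements where f and g agree form a subfield containing q, and Q(q) is
    the smallest one. *)
Lemma Qadj_rmorph_ext (L : fieldType) (f g : {rmorphism Qadj q -> L}) :
  f Qgen = g Qgen -> f =1 g.
Proof.
move=> fgq x.
pose K : {pred R} := fun y => `[< exists2 u : Qadj q, val u = y & f u = g u >].
have [] : exists2 u : Qadj q, val u = val x & f u = g u.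
  apply/asboolP; have /asboolP/(_ K) := Qadj_valP x; apply.
  - split; first by apply/asboolP; exists 1 => //; rewrite !rmorph1.
    + move=> y z /asboolP[u <- fgu] /asboolP[v <- fgv]; apply/asboolP.
      by exists (u - v); rewrite // !rmorphB fgu fgv.
    + move=> y z /asboolP[u <- fgu] /asboolP[v <- fgv]; apply/asboolP.
      exists (u / v); last by rewrite !fmorph_div fgu fgv.
      exact: (fmorph_div (val : {rmorphism Qadj q -> R})).
  - by apply/asboolP; exists Qgen.
by move=> u /val_inj ->.
Qed.

(** For algebraic q, Q[q] is already a field: a Bezout relation between p and
    g inverts g(q). *)
Lemma Qadj_horner (p : {poly rat}) (x : Qadj q) :
  irreducible_poly p -> root (map_poly ratr p) q ->
  exists g : {poly rat}, val x = (map_poly ratr g).[q].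
Proof.
move=> pirr pq.
pose K : {pred R} := fun y =>
  `[< exists g : {poly rat}, y = (map_poly ratr g).[q] >].
apply/asboolP; have /asboolP/(_ K) := Qadj_valP x; apply; last first.
  by apply/asboolP; exists 'X; rewrite map_polyX hornerX.
have KM y z : y \in K -> z \in K -> y * z \in K.
  move=> /asboolP[g ->] /asboolP[h ->]; apply/asboolP; exists (g * h).
  by rewrite rmorphM hornerM.
have KV y : y \in K -> y^-1 \in K.
  move=> /asboolP[g ->]; apply/asboolP.
  have [g0|g0] := eqVneq (map_poly ratr g).[q] 0.
    by exists 0; rewrite g0 invr0 rmorph0 horner0.
  have /Bezout_eq1_coprimepP[[u v] /= uv1] : coprimep p g.
    apply: contraNT g0 => npg; have [_ /(_ _ npg)] := pirr.
    move=> /(_ (dvdp_gcdl _ _))/andP[_ /dvdp_trans/(_ (dvdp_gcdr _ _)) pg].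
    by rewrite -rootE; apply: root_dvdp pq; rewrite dvdp_map.
  exists v; apply: (mulIf g0); rewrite mulVf // -hornerM -rmorphM.
  have := congr1 (fun h => (map_poly (ratr : rat -> R) h).[q]) uv1.
  rewrite rmorphD !rmorphM rmorph1 hornerD !hornerM (rootP pq) mulr0 add0r.
  by rewrite hornerC.
split.
- by apply/asboolP; exists 1; rewrite rmorph1 hornerC.
- move=> y z /asboolP[g ->] /asboolP[h ->]; apply/asboolP; exists (g - h).
  by rewrite rmorphB hornerD hornerN.
- by move=> y z yK zK; apply: KM => //; apply: KV.
Qed.

(** The embedding sends g(q) to g(z).  This does not depend on g, since the
    irreducible p divides every polynomial that vanishes at q. *)
Lemma Qadj_embedding (p : {poly rat}) (z : R[i]) :
  irreducible_poly p -> root (map_poly ratr p) q -> root (map_poly ratr p) z ->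
  exists f : {rmorphism Qadj q -> R[i]}, f Qgen = z.
Proof.
move=> pirr pq pz.
pose rep x := projT1 (cid (Qadj_horner x pirr pq)).
have repP x : val x = (map_poly ratr (rep x)).[q].
  exact: projT2 (cid (Qadj_horner x pirr pq)).
pose f x : R[i] := (map_poly ratr (rep x)).[z].
have fE x g : val x = (map_poly ratr g).[q] -> f x = (map_poly ratr g).[z].
  rewrite repP => xE; apply/eqP; rewrite -subr_eq0 -hornerN -hornerD -rmorphB.
  rewrite -rootE; apply: root_dvdp pz; rewrite dvdp_map.
  apply: (irreducible_dvdp_root pirr pq).
  by rewrite rootE rmorphB hornerD hornerN xE subrr.
have fB : zmod_morphism f.
  move=> x y; rewrite (fE _ (rep x - rep y)).
    by rewrite rmorphB hornerD hornerN.
  by rewrite rmorphB [in RHS]rmorphB hornerD hornerN -!repP.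
have fM : monoid_morphism f.
  split; first by rewrite (fE _ 1) !rmorph1 !hornerC.
  move=> x y; rewrite (fE _ (rep x * rep y)).
    by rewrite rmorphM hornerM.
  by rewrite rmorphM [in RHS]rmorphM hornerM -!repP.
pose fA := GRing.isZmodMorphism.Build _ _ f fB.
pose fMM := GRing.isMonoidMorphism.Build _ _ f fM.
pose F : {rmorphism Qadj q -> R[i]} := HB.pack f fA fMM.
exists F; rewrite -[LHS]/(f Qgen) (fE _ 'X) ?map_polyX ?hornerX //.
Qed.
End Adjunction.

Lemma norm_normc (R : rcfType) (z : R[i]) : `|z| = (Normc.normc z)%:C%C.
Proof. by []. Qed.

Lemma normc_ge0 (R : rcfType) (z : R[i]) : 0 <= Normc.normc z.
Proof. by rewrite -lecR -norm_normc normr_ge0. Qed.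

Lemma map_poly_fmorph_rat (K L : fieldType) (f : {rmorphism K -> L})
    (p : {poly rat}) : map_poly f (map_poly ratr p) = map_poly ratr p.
Proof.
rewrite -map_poly_comp_id0 ?rmorph0 //.
by apply: eq_map_poly => b /=; rewrite fmorph_rat.
Qed.

Lemma root_fmorph_rat (K L : fieldType) (f : {rmorphism K -> L})
    (p : {poly rat}) (x : K) :
  root (map_poly ratr p) (f x) = root (map_poly ratr p) x.
Proof. by rewrite -(map_poly_fmorph_rat f) fmorph_root. Qed.

Lemma integral_rat (F : numFieldType) (x : F) :
  integralOver (intr : int -> F) x -> integralOver (ratr : rat -> F) x.
Proof.
case=> p mp px; exists (map_poly intr p); first by rewrite monic_map.
rewrite -map_poly_comp; congr (root _ x): px.
by apply: eq_map_poly => b /=; rewrite ratr_int.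
Qed.

Section Embeddings.
Variables (R : realType) (q : R).

Lemma embedding_val : embeddings q (fun x => (val x)%:C%C).
Proof. by exists (real_complex R \o val). Qed.

(** The embeddings correspond to the roots of the minimal polynomial of q, by
    f |-> f q.  The enumeration therefore identifies the product over all
    embeddings with the norm. *)
Lemma embeddings_enum : integralOver (intr : int -> R) q ->
  exists s : seq (Qadj q -> R[i]), [/\ uniq s, embeddings q = [set` s] &
    forall u : Qadj q, integralOver (intr : int -> Qadj q) u -> u != 0 ->
      1 <= \prod_(f <- s) Normc.normc (f u)].
Proof.
move=> qint.
have [p [pirr mp pq]] := exists_minpoly (integral_rat qint).
have [zs] := closed_field_poly_normal (map_poly ratr p : {poly R[i]}).
rewrite lead_coef_map (monicP mp) rmorph1 scale1r => pzs.
have zP z : z \in zs -> root (map_poly ratr p) z by rewrite pzs root_prod_XsubC.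
have /choice[F FP] (z : R[i]) : exists f : {rmorphism Qadj q -> R[i]},
    z \in zs -> f (Qgen q) = z.
  have [/zP zr|_] := boolP (z \in zs); last by exists (real_complex R \o val).
  by have [f fz] := Qadj_embedding pirr pq zr; exists f.
exists (map (fun z => F z : Qadj q -> R[i]) zs); split.
- rewrite map_inj_in_uniq.
    rewrite -separable_prod_XsubC -pzs separable_map.
    exact: irreducible_separable.
  by move=> z w zzs wzs FE; rewrite -(FP _ zzs) -(FP _ wzs) FE.
- apply/seteqP; split=> [f [f' ->]|f /= /mapP[z zzs ->]]; last by exists (F z).
  have fzs : f' (Qgen q) \in zs.
    rewrite -root_prod_XsubC -pzs root_fmorph_rat.
    by rewrite -(root_fmorph_rat (val : {rmorphism Qadj q -> R})).
  apply/mapP; exists (f' (Qgen q)) => //.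
  by apply/funext => x; apply: Qadj_rmorph_ext; rewrite FP.
- move=> u uint u0; rewrite big_map.
  have [g gE] := Qadj_horner u pirr pq.
  have uE : u = (map_poly ratr g).[Qgen q].
    apply: val_inj; rewrite gE.
    rewrite -(map_poly_fmorph_rat (val : {rmorphism Qadj q -> R})).
    exact: (horner_map (val : {rmorphism Qadj q -> R}) _ (Qgen q)).
  have FE z : z \in zs -> F z u = (map_poly ratr g).[z].
    move=> zzs; rewrite {1}uE -(horner_map (F z)) map_poly_fmorph_rat.
    by congr (_.[_]); apply: FP.
  rewrite -lecR rmorph1 rmorph_prod /= big_seq.
  under eq_bigr => z zzs do rewrite -norm_normc FE //.
  rewrite -big_seq; apply: (prod_roots_ge1 _ mp pzs).
  + by case: pirr.
  + move=> z zzs; rewrite -FE //; case: uint => h mh hu; exists h => //.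
    rewrite (_ : intr = F z \o intr); last first.
      by apply/funext => b /=; rewrite rmorph_int.
    by rewrite map_poly_comp rmorph_root.
  + by move=> z zzs; rewrite -FE // fmorph_eq0.
Qed.

Lemma height_enum (s : seq (Qadj q -> R[i])) (a : Qadj q) :
  uniq s -> embeddings q = [set` s] ->
  height a = \prod_(f <- s) Num.max 1 (Normc.normc (f a)).
Proof. by move=> us sE; rewrite /height sE -fsbig_seq. Qed.

(** f q is a conjugate of q, and it differs from q because an embedding is
    determined by its value at q. *)
Lemma PV_embedding_lt1 (f : Qadj q -> R[i]) :
  PV_number q \/ PV_number (- q) -> embeddings q f ->
  f <> (fun x => (val x)%:C%C) -> Normc.normc (f (Qgen q)) < 1.
Proof.
move=> hq [{}f ->] fNval.
have conjP (w : Qadj q) : PV_number (val w) -> f w <> (val w)%:C%C ->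
    Normc.normc (f w) < 1.
  move=> [wint _ wconj] fw; apply: wconj => //.
  have [p [pirr mp pw]] := exists_minpoly (integral_rat wint).
  exists p; split=> //; rewrite root_fmorph_rat.
  by rewrite -(root_fmorph_rat (val : {rmorphism Qadj q -> R})).
have fq : f (Qgen q) <> q%:C%C.
  move=> fq; apply: fNval; apply/funext.
  exact: (@Qadj_rmorph_ext _ _ _ f (real_complex R \o val)).
case: hq => hq; first exact: conjP.
rewrite -ltcR -norm_normc -normrN -rmorphN norm_normc ltcR.
apply: conjP; first by rewrite rmorphN.
by rewrite !rmorphN => /oppr_inj.
Qed.

Lemma PV_norm_gt1 : PV_number q \/ PV_number (- q) -> 1 < `|q|.
Proof.
case=> [[_ q1 _]|[_ q1 _]]; first exact: lt_le_trans (ler_norm _).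
by rewrite -normrN; exact: lt_le_trans (ler_norm _).
Qed.

Lemma PV_integral : PV_number q \/ PV_number (- q) ->
  integralOver (intr : int -> R) q.
Proof.
by case=> [[]|[+ _ _]] // => /integral_opp; rewrite opprK.
Qed.

Lemma integral_val (x : Qadj q) :
  integralOver (intr : int -> R) (val x) ->
  integralOver (intr : int -> Qadj q) x.
Proof.
case=> p mp px; exists p => //.
rewrite -(fmorph_root (val : {rmorphism Qadj q -> R})) -map_poly_comp.
congr (root _ _): px; apply: eq_map_poly => b /=; apply/esym.
exact: (rmorph_int (val : {rmorphism Qadj q -> R})).
Qed.

(** A rational polynomial becomes integral after multiplication by an integer,
    and Q(q) = Q[q] with q integral. *)
Lemma common_denominator (m : nat) (c : 'I_m -> Qadj q) :
  integralOver (intr : int -> R) q ->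
  exists2 d : int, d != 0 &
    forall i, integralOver (intr : int -> Qadj q) (d%:~R * c i).
Proof.
move=> qint.
have [p [pirr mp pq]] := exists_minpoly (integral_rat qint).
have den1 (x : Qadj q) : exists d : int, d != 0 /\
    integralOver (intr : int -> Qadj q) (d%:~R * x).
  have [g gE] := Qadj_horner x pirr pq.
  have [h [a a0 ga]] := rat_poly_scale g.
  exists a; split=> //; apply: integral_val.
  have -> : val (a%:~R * x) = a%:~R * val x.
    rewrite (rmorphM (val : {rmorphism Qadj q -> R})).
    by rewrite (rmorph_int (val : {rmorphism Qadj q -> R})).
  rewrite gE ga map_polyZ hornerZ -map_poly_comp /=.
  rewrite fmorphV /= ratr_int mulVKf ?intr_eq0 //.
  apply: integral_horner => //; apply/integral_poly => i.
  by rewrite coef_map /= ratr_int; exact: integral_id.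
have /choice[d dP] i := den1 (c i).
exists (\prod_i d i); first by apply/prodf_neq0 => i _; case: (dP i).
move=> i; rewrite (bigD1 i) //= [d i * _]mulrC rmorphM -mulrA.
by apply: integral_mul; [exact: integral_id | case: (dP i)].
Qed.
End Embeddings.

(** * Power series with rapidly decreasing coefficients *)

Section EntireSeries.
Variable R : realType.

(** By Cauchy's estimates, these are the coefficient sequences of everywhere
    convergent power series.  In this form the property is stable under
    termwise differentiation by an elementary estimate. *)
Definition entire_coeffs (c : nat -> R) :=
  forall K, 0 < K -> exists C, forall n, `|c n| * K ^+ n <= C.

Lemma entire_coeffs_sum_bounded (c : nat -> R) (K : R) :
  entire_coeffs c -> 0 < K ->
  exists S, forall n, \sum_(0 <= k < n) `|c k| * K ^+ k <= S.
Proof.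
move=> ec K0; have K20 : 0 < 2 * K by rewrite mulr_gt0.
have [C Cc] := ec _ K20; exists (C / (1 - 2^-1)) => n.
have C0 : 0 <= C.
  by apply: le_trans (Cc 0); rewrite mulr_ge0 // exprn_ge0 // ltW.
apply: le_trans (@geometric_le_lim R n C 2^-1 C0 _ _); first last.
- by rewrite ger0_norm ?invr_ge0 // invf_lt1 // ltr1n.
- by rewrite invr_gt0.
rewrite /series /=; apply: ler_sum => k _.
rewrite exprVn ler_pdivlMr ?exprn_gt0 //.
by rewrite -mulrA -exprMn [K * 2]mulrC.
Qed.

Lemma entire_coeffs_cvg (c : nat -> R) (x : R) :
  entire_coeffs c -> cvgn (pseries c x).
Proof.
move=> ec; have K0 : 0 < `|x| + 1 by rewrite ltr_wpDl.
have [S Sc] := entire_coeffs_sum_bounded ec K0.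
apply: normed_cvg; apply: nondecreasing_is_cvgn.
  by apply: nondecreasing_series => n _ _; rewrite normr_ge0.
exists S => _ [n _ <-]; apply: le_trans (Sc n).
apply: ler_sum => k _ /=.
rewrite normrM normrX ler_wpM2l // lerXn2r ?nnegrE ?(ltW K0) //.
by rewrite lerDl.
Qed.

(** The factor n + 1 is absorbed by 2^(n+1), that is, by replacing K with
    2 K. *)
Lemma entire_coeffs_diffs (c : nat -> R) :
  entire_coeffs c -> entire_coeffs (pseries_diffs c).
Proof.
move=> ec K K0; have K20 : 0 < 2 * K by rewrite mulr_gt0.
have [C Cc] := ec _ K20; exists (C / K) => n.
rewrite ler_pdivlMr // -mulrA -exprSr /pseries_diffs normrM normr_nat.
apply: le_trans (Cc n.+1); rewrite exprMn [leRHS]mulrA.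
apply: ler_wpM2r; first by rewrite exprn_ge0 // ltW.
rewrite [leRHS]mulrC ler_wpM2r // -natrX ler_nat.
by rewrite ltnW // ltn_expl.
Qed.

Lemma entire_coeffs_iter_diffs (c : nat -> R) (j : nat) :
  entire_coeffs c -> entire_coeffs (iter j (@pseries_diffs R) c).
Proof. by move=> ec; elim: j => //= j; exact: entire_coeffs_diffs. Qed.

Lemma derive1n_pseries (c : nat -> R) (j : nat) : entire_coeffs c ->
  derive1n j (fun x => limn (pseries c x)) =
  (fun x => limn (pseries (iter j (@pseries_diffs R) c) x)).
Proof.
move=> ec; elim: j => [//|j IH]; rewrite derive1nS IH.
apply/funext => x; rewrite derive1E /=.
have ecj := entire_coeffs_iter_diffs j ec.
have D := @pseries_snd_diffs R _ (`|x| + 1) x (entire_coeffs_cvg ecj)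
  (entire_coeffs_cvg (entire_coeffs_diffs ecj))
  (entire_coeffs_cvg (entire_coeffs_diffs (entire_coeffs_diffs ecj))).
apply: derive_val; apply: D.
by rewrite [ltRHS]ger0_norm ?ltrDl // addr_ge0.
Qed.

Lemma iter_pseries_diffsE (c : nat -> R) (j k : nat) :
  iter j (@pseries_diffs R) c k = ((k + j) ^_ j)%:R * c (k + j)%N.
Proof.
elim: j k => [|j IH] k; first by rewrite addn0 ffactn0 mul1r.
rewrite /= {1}/pseries_diffs IH mulrA -natrM addSnnS; congr (_%:R * _).
by rewrite ffactnSr mulnC -addSnnS addnK.
Qed.

(** The coefficient of x^k in the j-th derivative has index k + j; reindexing
    by k + j keeps the original coefficients c k, so that the series for
    different j can be added termwise.  The terms with k < j vanish together
    with the falling factorial, whatever the truncated exponent. *)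
Lemma derive1n_pseries_cvg (c : nat -> R) (j : nat) (x : R) : entire_coeffs c ->
  \sum_(0 <= k < n) (k ^_ j)%:R * x ^+ (k - j) * c k @[n --> \oo] -->
  derive1n j (fun x => limn (pseries c x)) x.
Proof.
move=> ec; rewrite derive1n_pseries //.
rewrite -(cvg_shiftn j).
have := @entire_coeffs_cvg _ x (entire_coeffs_iter_diffs j ec).
suff -> : pseries (iter j (@pseries_diffs R) c) x =
    (fun n => \sum_(0 <= k < n + j) (k ^_ j)%:R * x ^+ (k - j) * c k) by [].
apply/funext => n; rewrite /pseries /series /=.
rewrite [RHS](big_cat_nat _ (n := j)) ?leq_addl //= [X in X + _]big_nat.
rewrite [X in X + _]big1 ?add0r; last first.
  by move=> k /andP[_ kj]; rewrite ffact_small // !mul0r.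
rewrite -{2}[j]add0n big_addn addnK; apply: eq_bigr => k _.
by rewrite iter_pseries_diffsE addnK mulrAC.
Qed.

(** Submultiplicativity of c lets the factor B^n |c n| be taken out of the
    n-th tail; what remains is dominated by the whole series. *)
Lemma tail_bound (c t : nat -> R) (B C L : R) :
  0 < B -> 0 <= C ->
  (forall n k, `|c (n + k)%N| <= `|c n| * `|c k|) ->
  entire_coeffs c -> (forall k, `|t k| <= C * (B ^+ k * `|c k|)) ->
  \sum_(0 <= k < n) t k @[n --> \oo] --> L ->
  exists2 D, 0 <= D &
    forall n, `|L - \sum_(0 <= k < n) t k| <= D * (B ^+ n * `|c n|).
Proof.
move=> B0 C0 csub ec tb tL.
have Bn0 k : 0 <= B ^+ k by rewrite exprn_ge0 // ltW.
have [S Sc] := entire_coeffs_sum_bounded ec B0.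
have S0 : 0 <= S by apply: le_trans (Sc 0%N); rewrite big_geq.
exists (C * S); first exact: mulr_ge0.
move=> n.
have : `|\sum_(0 <= k < N + n) t k - \sum_(0 <= k < n) t k| @[N --> \oo] -->
    `|L - \sum_(0 <= k < n) t k|.
  apply: cvg_norm; apply: cvgB; last exact: cvg_cst.
  by move: tL; rewrite -(cvg_shiftn n).
move=> /cvgr_to_le; apply; near=> N.
rewrite (big_cat_nat _ (n := n)) ?leq_addl //= [X in X - _]addrC addrK.
rewrite -{1}[n]add0n big_addn addnK.
apply: le_trans (ler_norm_sum _ _ _) _.
apply: (@le_trans _ _ (\sum_(0 <= k < N)
    C * (B ^+ n * `|c n|) * (`|c k| * B ^+ k))).
  apply: ler_sum => k _; apply: le_trans (tb _) _.
  rewrite -[leRHS]mulrA ler_wpM2l // -[leRHS]mulrA [(k + n)%N]addnC exprD.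
  rewrite -[leLHS]mulrA ler_wpM2l // [leRHS]mulrA [leRHS]mulrC.
  by rewrite ler_wpM2l.
rewrite -mulr_sumr [leRHS]mulrAC ler_wpM2l //.
by rewrite !mulr_ge0.
Unshelve. all: by end_near. Qed.
End EntireSeries.

(** * The Tschakaloff series *)

Lemma geometric_eventually_lt (R : realType) (a z e : R) :
  0 <= z < 1 -> 0 < e -> exists N, forall n, (N <= n)%N -> a * z ^+ n < e.
Proof.
move=> /andP[z0 z1] e0.
have az : geometric a z n @[n --> \oo] --> 0.
  by apply: cvg_geometric; rewrite ger0_norm.
have /cvgr_lt/(_ e e0)[N _ HN] := az.
by exists N => n /HN.
Qed.

Section TschakaloffSeries.
Variables (R : realType) (q : R).
Hypothesis q1 : 1 < `|q|.

Definition Tcoef (n : nat) : R := (q ^+ 'C(n.+1, 2))^-1.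

Lemma norm_TcoefS (n : nat) : `|Tcoef n.+1| = `|Tcoef n| / `|q| ^+ n.+1.
Proof. by rewrite /Tcoef binS bin1 exprD invfM normrM !normfV !normrX. Qed.

(** The quotient of consecutive terms is K / |q|^(n+1), which is at most 1 from
    some index N on; so the sequence is bounded by its first N + 1 terms. *)
Lemma Tcoef_entire : entire_coeffs Tcoef.
Proof.
move=> K K0; have q0 : 0 < `|q| by apply: lt_trans q1.
have qV1 : 0 <= `|q|^-1 < 1 by rewrite invr_ge0 normr_ge0 invf_lt1.
have KV0 : 0 < K^-1 by rewrite invr_gt0.
have [N HN] := geometric_eventually_lt 1 qV1 KV0.
have {}HN n : (N <= n)%N -> K <= `|q| ^+ n.+1.
  move=> Nn; have := HN _ (leqW Nn).
  by rewrite mul1r exprVn ltf_pV2 ?posrE ?exprn_gt0 // => /ltW.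
pose f n := `|Tcoef n| * K ^+ n.
have f0 n : 0 <= f n by rewrite mulr_ge0 // exprn_ge0 // ltW.
exists (\sum_(i < N.+1) f i) => n; rewrite -/(f n).
have le_small m : (m <= N)%N -> f m <= \sum_(i < N.+1) f i.
  move=> mN; rewrite (bigD1 (inord m)) //= inordK // lerDl.
  by apply: sumr_ge0 => i _.
have [/le_small //|Nn] := leqP n N.
apply: le_trans (le_small N _) => //.
rewrite -(subnKC (ltnW Nn)); elim: (n - N)%N => [|k IH]; first by rewrite addn0.
apply: le_trans IH; rewrite addnS /f norm_TcoefS -mulrA ler_wpM2l //.
rewrite [K ^+ _.+1]exprS mulrA ler_piMl ?exprn_ge0 ?(ltW K0) //.
rewrite mulrC ler_pdivrMr ?exprn_gt0 // mul1r.
by apply: HN; exact: leq_addr.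
Qed.

(** The exponents satisfy C(n+k+1, 2) = C(n+1, 2) + C(k+1, 2) + n k. *)
Lemma Tcoef_submul (n k : nat) : `|Tcoef (n + k)| <= `|Tcoef n| * `|Tcoef k|.
Proof.
have q0 : 0 < `|q| by apply: lt_trans q1.
rewrite /Tcoef -normrM -invfM -exprD !normfV !normrX.
rewrite lef_pV2 ?posrE ?exprn_gt0 //; apply: ler_weXn2l; first exact: ltW.
have : ('C((n + k).+1, 2) = 'C(n.+1, 2) + 'C(k.+1, 2) + n * k)%N.
  elim: k => [|k IH]; first by rewrite addn0 muln0 !addn0.
  by rewrite addnS binS bin1 IH [in RHS](binS k.+1) bin1 mulnS; ring.
by move=> ->; exact: leq_addr.
Qed.

Lemma TschakaloffE : Tschakaloff q = fun x => limn (pseries Tcoef x).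
Proof.
apply/funext => x; rewrite /Tschakaloff.
have cx : pseries Tcoef x n @[n --> \oo] --> limn (pseries Tcoef x).
  by apply: entire_coeffs_cvg; exact: Tcoef_entire.
suff h : \sum_(1 <= n < N) (x ^+ n / q ^+ (n * n.+1)./2) @[N --> \oo] -->
    limn (pseries Tcoef x) - 1.
  by rewrite (cvg_lim _ h) // addrC subrK.
rewrite -(cvg_shiftn 1); rewrite -(cvg_shiftn 1) in cx.
have c1 : (fun=> 1 : R) n @[n --> \oo] --> (1 : R) by exact: cvg_cst.
suff -> : [sequence \sum_(1 <= i < n + 1) (x ^+ i / q ^+ (i * i.+1)./2)]_n =
  [sequence pseries Tcoef x (n + 1)%N]_n \- (fun=> 1) by exact: cvgB cx c1.
apply/funext => n; rewrite /pseries /series /= addn1 [in RHS]big_ltn //.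
rewrite /Tcoef bin_small // expr0 invr1 mul1r expr0 [1 + _]addrC addrK.
by apply: eq_bigr => k _; rewrite mulrC bin2 /= mulnC.
Qed.

End TschakaloffSeries.

(** * Falling factorials and the recurrence *)

(** The term of index j in the binomial expansion of
    rho^k = (1 + (rho - 1))^k. *)
Lemma ffact_le_exp (F : numFieldType) (rho : F) (j k : nat) : 1 < rho ->
  (k ^_ j)%:R * (rho - 1) ^+ j <= j`!%:R * rho ^+ k.
Proof.
move=> rho1; have e0 : 0 <= rho - 1 by rewrite subr_ge0 ltW.
rewrite -bin_ffact mulnC natrM -mulrA ler_wpM2l //.
have [kj|jk] := ltnP k j.
  by rewrite bin_small // mul0r exprn_ge0 // (le_trans ler01) // ltW.
rewrite -{2}[rho](subrK 1) exprD1n mulr_natl.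
have jk' : (j < k.+1)%N by [].
rewrite (bigD1 (Ordinal jk')) //= lerDl.
by apply: sumr_ge0 => i _; rewrite mulrn_wge0 // exprn_ge0.
Qed.

(** Induction by finite differences: the difference operator sends the falling
    factorial of order j + 1 to j + 1 times that of order j. *)
Lemma ffact_free (K : fieldType) (m n0 : nat) (B : nat -> K) :
  (forall n, n.+1%:R != 0 :> K) ->
  (forall k, (n0 <= k)%N -> \sum_(j < m.+1) B j * (k ^_ j)%:R = 0) ->
  forall j, (j <= m)%N -> B j = 0.
Proof.
move=> char0; elim: m B => [|m IH] B BE.
  move=> [|//] _; have := BE n0 (leqnn _).
  by rewrite big_ord1 ffactn0 mulr1.
have ffD k j : (k.+1 ^_ j.+1 = k ^_ j.+1 + j.+1 * k ^_ j)%N.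
  rewrite ffactSS ffactnSr; have [jk|kj] := leqP j k.
    by rewrite [(k ^_ j * _)%N]mulnC -mulnDl addnS subnK.
  by rewrite ffact_small // !muln0.
have BS j : (j <= m)%N -> B j.+1 = 0.
  move=> jm; suff /eqP : B j.+1 * j.+1%:R = 0.
    by rewrite mulf_eq0 (negPf (char0 j)) orbF => /eqP.
  apply: (IH (fun j => B j.+1 * j.+1%:R)) jm => k n0k.
  have := BE k.+1 (leqW n0k); have := BE k n0k.
  rewrite big_ord_recl [in X in _ -> X -> _]big_ord_recl !ffactn0 => e1 e2.
  have e3 := congr2 (fun x y => x - y) e2 e1.
  rewrite /= [0 - 0]subrr opprD addrACA subrr add0r -sumrB in e3.
  apply: etrans e3; apply: eq_bigr => i _.
  by rewrite /bump /= add1n ffD natrD mulrDr addrC addKr natrM mulrA.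
move=> [_|j]; last exact: BS.
have := BE n0 (leqnn _); rewrite big_ord_recl ffactn0 mulr1 big1 ?addr0 //.
by move=> i _; rewrite BS ?mul0r // -ltnS.
Qed.

Lemma integral_expr (B L : comNzRingType) (i : {rmorphism B -> L}) (x : L) n :
  integralOver i x -> integralOver i (x ^+ n).
Proof.
move=> ix; elim: n => [|n IH]; first by rewrite expr0; exact: integral1.
by rewrite exprS; exact: integral_mul.
Qed.

Section Recurrence.
Variables (K : fieldType) (Q alpha A0 : K) (A : nat -> K) (m : nat).

(** The value at alpha of sum_j A_j (x^k)^(j), that is, the coefficient with
    which 1 / q^(k(k+1)/2) enters sum_j A_j T^(j)(alpha). *)
Definition comb_coef (k : nat) : K :=
  \sum_(j < m.+1) A j * (k ^_ j)%:R * alpha ^+ (k - j).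

(** If A0 + sum_k b_k / Q^(k(k+1)/2) = 0, where b_k is [comb_coef k], then
    [remainder n] is Q^(n(n-1)/2) times the n-th tail of the series.  The
    recurrence makes sense under every embedding and keeps integrality. *)
Fixpoint remainder (n : nat) : K :=
  if n is n'.+1 then Q ^+ n' * remainder n' - comb_coef n' else - A0.

Lemma remainder_integral (n : nat) :
  integralOver (intr : int -> K) Q -> integralOver (intr : int -> K) alpha ->
  integralOver (intr : int -> K) A0 ->
  (forall j, (j <= m)%N -> integralOver (intr : int -> K) (A j)) ->
  integralOver (intr : int -> K) (remainder n).
Proof.
move=> iQ ia iA0 iA.
have icoef k : integralOver (intr : int -> K) (comb_coef k).
  apply: (big_ind (integralOver (intr : int -> K))).
  - exact: mxpoly.integral0.
  - by move=> x y; exact: integral_add.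
  - move=> j _; apply: integral_mul; last exact: integral_expr.
    by apply: integral_mul; [apply: iA; rewrite -ltnS | exact: integral_nat].
elim: n => [|n IH] /=; first exact: integral_opp.
by apply: integral_sub => //; apply: integral_mul => //; exact: integral_expr.
Qed.

Lemma comb_coef_bound (F : numFieldType) (f : {rmorphism K -> F}) (rho : F) :
  1 < rho -> alpha != 0 ->
  exists2 C, 0 <= C &
    forall k, `|f (comb_coef k)| <= C * (rho * `|f alpha|) ^+ k.
Proof.
move=> rho1 a0; have e0 : 0 < rho - 1 by rewrite subr_gt0.
have fa0 : 0 < `|f alpha| by rewrite normr_gt0 fmorph_eq0.
have rho0 : 0 < rho by apply: lt_trans rho1.
pose C j := `|f (A j)| * (j`!%:R / (rho - 1) ^+ j) / `|f alpha| ^+ j.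
have C0 j : 0 <= C j.
  by rewrite !mulr_ge0 ?invr_ge0 ?exprn_ge0 ?(ltW e0).
exists (\sum_(j < m.+1) C j); first exact: sumr_ge0.
move=> k; rewrite rmorph_sum /= mulr_suml.
apply: le_trans (ler_norm_sum _ _ _) _; apply: ler_sum => j _.
rewrite !rmorphM rmorph_nat rmorphXn /= !normrM normr_nat normrX.
have [kj|jk] := ltnP k j.
  rewrite ffact_small // mulr0 mul0r mulr_ge0 // exprn_ge0 // mulr_ge0 //.
  exact: ltW.
have -> : `|f alpha| ^+ (k - j) = `|f alpha| ^+ k / `|f alpha| ^+ j.
  by rewrite -[in X in _ = X / _](subnK jk) exprD mulfK // expf_neq0 // gt_eqF.
rewrite exprMn /C -!mulrA ler_wpM2l // [leRHS]mulrCA [leLHS]mulrCA.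
rewrite [leRHS](_ : _ = `|f alpha| ^+ k * (`|f alpha| ^- j *
  ((rho - 1) ^- j * (j`!%:R * rho ^+ k)))); last by ring.
rewrite [leLHS](_ : _ = `|f alpha| ^+ k * (`|f alpha| ^- j *
  (k ^_ j)%:R)); last by ring.
rewrite ler_wpM2l ?exprn_ge0 // ler_wpM2l ?invr_ge0 ?exprn_ge0 //.
by rewrite mulrC ler_pdivlMr ?exprn_gt0 // ffact_le_exp.
Qed.

(** With D (rho - 1) >= C, the bound propagates along the recurrence: the
    factor Q^n does not increase absolute values, and D rho >= D + C. *)
Lemma remainder_bound (F : numFieldType) (f : {rmorphism K -> F}) (rho M : F) :
  1 < rho -> alpha != 0 -> `|f Q| <= 1 -> 1 <= M -> `|f alpha| <= M ->
  exists2 D, 0 <= D & forall n, `|f (remainder n)| <= D * (rho * M) ^+ n.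
Proof.
move=> rho1 a0 fQ1 M1 faM.
have [C C0 bC] := comb_coef_bound f rho1 a0.
have e0 : 0 < rho - 1 by rewrite subr_gt0.
have rho0 : 0 < rho by apply: lt_trans rho1.
have M0 : 0 < M by apply: lt_le_trans M1.
have Bn0 n : 0 <= (rho * M) ^+ n by rewrite exprn_ge0 // mulr_ge0 // ltW.
pose D := `|f A0| + C / (rho - 1).
have D0 : 0 <= D by rewrite addr_ge0 // divr_ge0 // ltW.
exists D => //; elim=> [|n IH] /=.
  by rewrite rmorphN normrN expr0 mulr1 lerDl divr_ge0 // ltW.
rewrite rmorphB rmorphM rmorphXn /=.
apply: le_trans (ler_normB _ _) _.
apply: (@le_trans _ _ (D * (rho * M) ^+ n + C * (rho * M) ^+ n)).
  apply: lerD.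
    rewrite normrM normrX; apply: le_trans IH.
    by rewrite ler_piMl // exprn_ile1.
  apply: le_trans (bC n) _; rewrite ler_wpM2l //.
  rewrite lerXn2r ?nnegrE ?mulr_ge0 ?(ltW rho0) ?(ltW M0) //.
  by rewrite ler_wpM2l // ltW.
rewrite -mulrDl exprS mulrA ler_wpM2r //.
apply: (@le_trans _ _ (D * rho)).
  rewrite -lerBrDl -[X in _ - X]mulr1 -mulrBr mulrDl divfK ?gt_eqF // lerDr.
  by rewrite mulr_ge0 // ltW.
by rewrite ler_wpM2l // ler_peMr // ltW.
Qed.
End Recurrence.

(** * Linear independence *)

(** Continuity of rho^N at 1, by induction on N: if r^N < y, any rho in ]1, r]
    smaller than y / r^N satisfies rho^(N+1) < y. *)
Lemma exists_gt1_exp_lt (R : realFieldType) (N : nat) (y : R) :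
  1 < y -> exists2 rho, 1 < rho & rho ^+ N < y.
Proof.
move=> y1; elim: N => [|N [r r1 rN]]; first by exists y; rewrite ?expr0.
have r0 : 0 < r by apply: lt_trans r1.
have rN0 : 0 < r ^+ N by rewrite exprn_gt0.
have q1 : 1 < y / r ^+ N by rewrite ltr_pdivlMr // mul1r.
pose rho := Num.min r ((1 + y / r ^+ N) / 2).
have rho1 : 1 < rho by rewrite lt_min r1 midf_lt.
exists rho => //; rewrite exprSr.
have rho0 : 0 <= rho by rewrite ltW // (lt_trans ltr01).
apply: (@le_lt_trans _ _ (r ^+ N * rho)).
  by rewrite ler_wpM2r // lerXn2r ?nnegrE ?ge_min ?lexx // ltW.
rewrite mulrC -ltr_pdivlMr //; apply: (@le_lt_trans _ _ ((1 + y / r ^+ N) / 2)).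
  by rewrite ge_min lexx orbT.
by rewrite midf_lt.
Qed.

Section Relations.
Variables (R : realType) (q : R).
Hypothesis hq : PV_number q \/ PV_number (- q).
Variable alpha : Qadj q.
Hypothesis alpha0 : alpha != 0.

Notation Q := (Qgen q).
(* This is val.  It stays abstract because val computes on sums and products,
   which would hide that it is a morphism. *)
Variable incl : {rmorphism Qadj q -> R}.
Hypothesis inclE : incl =1 val.

Lemma Qadj_char0 (n : nat) : n.+1%:R != 0 :> Qadj q.
Proof.
by rewrite -(fmorph_eq0 incl) rmorph_nat pnatr_eq0.
Qed.

Lemma val_remainder (A0 : Qadj q) (A : nat -> Qadj q) (m n : nat) :
  incl (remainder Q alpha A0 A m n) =
  q ^+ 'C(n, 2) *
    (- incl A0 - \sum_(0 <= k < n) incl (comb_coef alpha A m k) * Tcoef q k).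
Proof.
have q0 : q != 0 by rewrite -normr_gt0 (lt_trans ltr01) // PV_norm_gt1.
elim: n => [|n IH].
  by rewrite /= bin_small // expr0 mul1r big_geq // subr0 rmorphN.
rewrite big_nat_recr //= rmorphB rmorphM rmorphXn IH.
rewrite (inclE Q) binS bin1 opprD addrA [RHS]mulrDr mulrN; congr (_ - _).
  by rewrite mulrA -exprD addnC.
by rewrite /Tcoef binS bin1 mulrCA divff ?mulr1 // expf_neq0.
Qed.

Lemma comb_coef_cvg (A : nat -> Qadj q) (m : nat) :
  \sum_(0 <= k < n) incl (comb_coef alpha A m k) * Tcoef q k @[n --> \oo] -->
  \sum_(j < m.+1) incl (A j) * derive1n j (Tschakaloff q) (val alpha).
Proof.
have q1 := PV_norm_gt1 hq.
pose F (j n : nat) : R := incl (A j) *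
  (\sum_(0 <= k < n) (k ^_ j)%:R * val alpha ^+ (k - j) * Tcoef q k).
have Fcvg j : F j n @[n --> \oo] -->
    incl (A j) * derive1n j (Tschakaloff q) (val alpha).
  rewrite TschakaloffE //; apply: cvgM; first exact: cvg_cst.
  by apply: derive1n_pseries_cvg; exact: Tcoef_entire.
have sum_cvg M : \sum_(j < M) F j n @[n --> \oo] -->
    \sum_(j < M) incl (A j) * derive1n j (Tschakaloff q) (val alpha).
  elim: M => [|M IH].
    by rewrite big_ord0; under eq_fun do rewrite big_ord0; exact: cvg_cst.
  rewrite big_ord_recr; under eq_fun do rewrite big_ord_recr.
  by apply: cvgD; [exact: IH | exact: Fcvg].
suff -> : (fun n => \sum_(0 <= k < n) incl (comb_coef alpha A m k) * Tcoef q k) =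
  (fun n => \sum_(j < m.+1) F j n) by exact: sum_cvg.
apply/funext => n; rewrite /F -inclE.
under [RHS]eq_bigr do rewrite mulr_sumr.
rewrite exchange_big /=; apply: eq_bigr => k _.
rewrite /comb_coef rmorph_sum mulr_suml; apply: eq_bigr => j _.
by rewrite !rmorphM rmorph_nat rmorphXn /= !mulrA.
Qed.

(** The n-th tail is O((rho |alpha|)^n / |q|^(n(n+1)/2)) by [tail_bound], and
    the factor q^(n(n-1)/2) leaves |q|^(-n). *)
Lemma val_remainder_bound (A0 : Qadj q) (A : nat -> Qadj q) (m : nat) (rho : R) :
  1 < rho ->
  incl A0 +
    \sum_(j < m.+1) incl (A j) * derive1n j (Tschakaloff q) (val alpha) = 0 ->
  exists2 D, 0 <= D & forall n, `|incl (remainder Q alpha A0 A m n)| <=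
    D * (rho * (`|incl alpha| / `|q|)) ^+ n.
Proof.
move=> rho1 rel; have q1 := PV_norm_gt1 hq.
have q0 : 0 < `|q| by apply: lt_trans q1.
have a0 : 0 < `|incl alpha| by rewrite normr_gt0 fmorph_eq0.
have B0 : 0 < rho * `|incl alpha| by rewrite mulr_gt0 // (lt_trans ltr01).
have [C C0 bC] := comb_coef_bound A m incl rho1 alpha0.
have [|D D0 bD] := tail_bound B0 C0 (Tcoef_submul q1) (Tcoef_entire q1) _
  (@comb_coef_cvg A m).
  move=> k; rewrite normrM mulrA; apply: ler_wpM2r => //; exact: bC.
exists D => // n; rewrite val_remainder normrM normrX.
have -> : - incl A0 =
    \sum_(j < m.+1) incl (A j) * derive1n j (Tschakaloff q) (val alpha).
  by apply/eqP; rewrite eq_sym -addr_eq0 addrC rel.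
apply: (@le_trans _ _ (`|q| ^+ 'C(n, 2) *
    (D * ((rho * `|incl alpha|) ^+ n * `|Tcoef q n|)))).
  by apply: ler_wpM2l; rewrite ?exprn_ge0.
rewrite /Tcoef normfV normrX binS bin1 exprD mulrCA ler_wpM2l //.
have qn0 k : `|q| ^+ k != 0 by rewrite expf_neq0 // gt_eqF.
by rewrite invfM mulrCA mulVKf // mulrA -expr_div_n.
Qed.

(** The norm argument: the remainders are algebraic integers whose norms tend
    to 0, so they vanish from some index on. *)
Lemma relation_trivial_integral (A0 : Qadj q) (A : nat -> Qadj q) (m : nat) :
  integralOver (intr : int -> Qadj q) alpha ->
  Num.min 1 `|incl alpha| * height alpha < `|q| ->
  integralOver (intr : int -> Qadj q) A0 ->
  (forall j, (j <= m)%N -> integralOver (intr : int -> Qadj q) (A j)) ->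
  incl A0 +
    \sum_(j < m.+1) incl (A j) * derive1n j (Tschakaloff q) (val alpha) = 0 ->
  forall j, (j <= m)%N -> A j = 0.
Proof.
move=> ia hlt iA0 iA rel.
have q1 := PV_norm_gt1 hq; have q0 : 0 < `|q| by apply: lt_trans q1.
have a0 : 0 < `|incl alpha| by rewrite normr_gt0 fmorph_eq0.
have iq := PV_integral hq.
have [s [us sE norm_ge1]] := embeddings_enum iq.
pose i0 : Qadj q -> R[i] := fun x => (incl x)%:C%C.
have i0E : i0 = (fun x => (val x)%:C%C) by apply/funext => x; rewrite /i0 inclE.
have i0s : i0 \in s by have := embedding_val q; rewrite sE -i0E.
(* W f is the geometric rate of f (u n), up to the factor rho; the hypothesis
   on the height says exactly that the product theta of the rates is < 1. *)
pose W (f : Qadj q -> R[i]) :=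
  if f == i0 then `|incl alpha| / `|q| else Num.max 1 (Normc.normc (f alpha)).
have W0 f : 0 < W f.
  by rewrite /W; case: ifP => _; rewrite ?divr_gt0 // lt_max ltr01.
pose theta := \prod_(f <- s) W f.
have norm_i0 x : Normc.normc (i0 x) = `|incl x|.
  by apply: complexI; rewrite -norm_normc normc_def /= expr0n addr0 sqrtr_sqr.
have theta1 : theta < 1.
  move: hlt; rewrite (height_enum alpha us sE) /theta (bigD1_seq _ i0s us).
  rewrite [X in _ -> X < _](bigD1_seq i0) //= {1}/W eqxx expr0n addr0 sqrtr_sqr.
  rewrite [X in _ -> _ * X < _](eq_bigr
    (fun f => Num.max 1 (Normc.normc (f alpha)))); last first.
    by move=> f /negPf fi; rewrite /W fi.
  have minmax x : Num.min 1 x * Num.max 1 x = x :> R.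
    by case: (leP 1 x) => _; rewrite ?mul1r ?mulr1.
  by rewrite mulrA minmax => h; rewrite mulrAC ltr_pdivrMr // mul1r.
have theta0 : 0 < theta by apply: prodr_gt0.
have [rho rho1 rho_theta] :
    exists2 rho, 1 < rho & rho ^+ size s * theta < 1.
  have tV1 : 1 < theta^-1 by rewrite invf_gt1.
  have [rho r1 rt] := exists_gt1_exp_lt (size s) tV1; exists rho => //.
  by rewrite -ltr_pdivlMr // mul1r.
have rho0 : 0 < rho by apply: lt_trans rho1.
pose u n := remainder Q alpha A0 A m n.
(* One constant D f for each embedding, from the tail estimate at the identity
   and from the recurrence elsewhere. *)
have /choice[D DP] f : exists D, f \in s ->
    0 <= D /\ forall n, Normc.normc (f (u n)) <= D * (rho * W f) ^+ n.
  have [fs|_] := boolP (f \in s); last by exists 0.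
  have [fi|fi] := eqVneq f i0.
    have [D D0 bD] := val_remainder_bound rho1 rel.
    by exists D => _; split=> // n; rewrite fi norm_i0 /W eqxx.
  have /= ef : embeddings q f by rewrite sE.
  have fQ : Normc.normc (f Q) < 1.
    by apply: PV_embedding_lt1 hq ef _; rewrite -i0E; exact/eqP.
  case: ef => f' fE.
  have rho1C : 1 < rho%:C%C by rewrite -(rmorph1 (real_complex R)) ltcR.
  have [||| D D0 bD] := @remainder_bound _ Q alpha A0 A m _ f' rho%:C%C
      (W f)%:C%C rho1C alpha0.
  - by rewrite -(rmorph1 (real_complex R)) -fE norm_normc lecR ltW.
  - by rewrite -(rmorph1 (real_complex R)) lecR /W (negPf fi) le_max lexx.
  - by rewrite -fE norm_normc lecR /W (negPf fi) le_max lexx orbT.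
  have [d dE] : exists d, D = d%:C%C.
    by exists (complex.Re D); rewrite RRe_real // ger0_real.
  rewrite dE in D0 bD; exists d => _; split; first by rewrite -lecR.
  move=> n; have := bD n; rewrite -fE norm_normc.
  by rewrite -[_ * (W f)%:C%C]rmorphM -rmorphXn -rmorphM lecR.
have [n0 Hn0] : exists n0, forall n, (n0 <= n)%N -> u n = 0.
  have zP : 0 <= rho ^+ size s * theta < 1.
    by rewrite rho_theta andbT mulr_ge0 ?exprn_ge0 ?(ltW rho0) ?(ltW theta0).
  have [n0 Hn0] := geometric_eventually_lt (\prod_(f <- s) D f) zP ltr01.
  exists n0 => n n0n; apply/eqP; apply: contraTT (Hn0 n n0n) => un0.
  rewrite -leNgt.
  have iQ : integralOver (intr : int -> Qadj q) Q by apply: integral_val.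
  apply: le_trans (norm_ge1 (u n) (remainder_integral n iQ ia iA0 iA) un0) _.
  rewrite -[rho ^+ _]iter_mulr_1 -(count_predT s) -big_const_seq.
  rewrite -big_split /= -prodrXl -big_split /=.
  rewrite big_seq [leRHS]big_seq.
  by apply: ler_prod => f fs; rewrite normc_ge0; case: (DP f fs) => _ ->.
have coef0 k : (n0 <= k)%N -> comb_coef alpha A m k = 0.
  move=> n0k; have := Hn0 k.+1 (leqW n0k); rewrite /u /= -/(u k) Hn0 //.
  by rewrite mulr0 sub0r => /eqP; rewrite oppr_eq0 => /eqP.
move=> j jm; have aj : alpha ^+ j != 0 by rewrite expf_neq0.
suff /eqP : A j / alpha ^+ j = 0.
  by rewrite mulf_eq0 invr_eq0 (negPf aj) orbF => /eqP.
apply: (ffact_free (n0 := n0) Qadj_char0 (B := fun j => A j / alpha ^+ j)) jm.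
move=> k n0k; have ak : alpha ^+ k != 0 by rewrite expf_neq0.
(* Term by term: alpha^(k - i) is alpha^k / alpha^i if i <= k, and otherwise
   the falling factorial vanishes. *)
apply: (mulIf ak); rewrite mul0r -[RHS](coef0 k n0k) mulr_suml.
apply: eq_bigr => i _; have [ki|ik] := ltnP k i.
  by rewrite ffact_small // !mulr0 !mul0r.
have -> : alpha ^+ k = alpha ^+ (k - i) * alpha ^+ i by rewrite -exprD subnK.
by field; rewrite expf_neq0.
Qed.

Lemma relation_trivial (A0 : Qadj q) (A : nat -> Qadj q) (m : nat) :
  integralOver (intr : int -> Qadj q) alpha ->
  Num.min 1 `|incl alpha| * height alpha < `|q| ->
  incl A0 +
    \sum_(j < m.+1) incl (A j) * derive1n j (Tschakaloff q) (val alpha) = 0 ->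
  A0 = 0 /\ forall j, (j <= m)%N -> A j = 0.
Proof.
move=> ia hlt rel.
(* A0 and the A j are gathered in one family to get a common denominator. *)
pose c (i : 'I_m.+2) := if i is Ordinal i'.+1 _ then A i' else A0.
have [d d0 dP] := common_denominator c (PV_integral hq).
have d0' : d%:~R != 0 :> Qadj q.
  by rewrite -(fmorph_eq0 incl) rmorph_int intr_eq0.
have A_0 : forall j, (j <= m)%N -> A j = 0.
  have h : forall j, (j <= m)%N -> d%:~R * A j = 0.
    apply: (@relation_trivial_integral (d%:~R * A0) (fun j => d%:~R * A j)) => //.
    - exact: (dP ord0).
    - by move=> j jm; exact: (dP (@Ordinal m.+2 j.+1 jm)).
    - rewrite rmorphM -[RHS](mulr0 (incl d%:~R)) -[X in _ = _ * X]rel.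
      rewrite mulrDr mulr_sumr.
      congr (_ + _); apply: eq_bigr => j _.
      by rewrite rmorphM mulrA.
  by move=> j /h/eqP; rewrite mulf_eq0 (negPf d0') => /eqP.
split=> //; apply/eqP; rewrite -(fmorph_eq0 incl); apply/eqP.
move: rel; rewrite big1 ?addr0 // => j _.
by rewrite A_0 ?rmorph0 ?mul0r // -ltnS.
Qed.
End Relations.

(** Indexing the scalars by natural numbers avoids the ordinals bounded by the
    size of s, which does not compute when s is built from a variable
    length. *)
Lemma lin_indep_nat (K L : fieldType) (iota : {rmorphism K -> L}) (s : seq L) :
  (forall c : nat -> K, \sum_(0 <= i < size s) iota (c i) * s`_i = 0 ->
     forall i, (i < size s)%N -> c i = 0) ->
  lin_indep iota s.
Proof.
move=> h c cE i.
pose c' k := if insub k is Some i then c i else 0.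
have c'E (j : 'I_(size s)) : c' j = c j by rewrite /c' valK.
rewrite -c'E; apply: h => //; rewrite big_mkord -[RHS]cE.
by apply: eq_bigr => j _; rewrite c'E.
Qed.

Theorem corollary1p3 (R : realType) (q : R)
    (hq : PV_number q \/ PV_number (- q))
    (alpha : Qadj q)
    (halpha : integralOver (intr : int -> Qadj q) alpha)
    (hpos : 0 < Num.min 1 `|val alpha| * height alpha)
    (hlt : Num.min 1 `|val alpha| * height alpha < `|q|)
    (m : nat) :
  lin_indep (val : {rmorphism Qadj q -> R})
    (1 :: [seq derive1n j (Tschakaloff q) (val alpha) | j <- iota 0 m.+1]).
Proof.
have alpha0 : alpha != 0.
  apply: contraTneq hpos => ->.
  rewrite (rmorph0 (val : {rmorphism Qadj q -> R})).
  by rewrite normr0 min_r ?ler01 // mul0r ltxx.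
apply: lin_indep_nat => c; rewrite [size _]/= size_map size_iota => rel.
have rel' : val (c 0%N) + \sum_(j < m.+1) val (c j.+1) *
    derive1n j (Tschakaloff q) (val alpha) = 0.
  rewrite -[RHS]rel big_nat_recl // big_mkord [_`_0]/= mulr1; congr (_ + _).
  apply: eq_bigr => j _; congr (_ * _); rewrite -[RHS]/(nth 0
    [seq derive1n i (Tschakaloff q) (val alpha) | i <- iota 0 m.+1] j).
  by rewrite (nth_map 0%N) ?size_iota // nth_iota.
have [c0 cS] := @relation_trivial R q hq alpha alpha0
  (val : {rmorphism Qadj q -> R}) (fun=> erefl) (c 0%N) (fun j => c j.+1) m
  halpha hlt rel'.
by case=> [|j] //; rewrite !ltnS => /cS.
Qed.
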